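(* Let $C_1,\dots,C_T\in\mathbb{R}^{n\times n}$ be symmetric with $0\preceq C_t\preceq I$, $T\ge1$, and let $\mathscr{B}^n_1$ be the set of density matrices (symmetric positive semidefinite with trace $1$). Run the following algorithm: start from $Y_1\in\mathscr{B}^n_1$; at each $t$ eigendecompose $Y_t=\widehat D\mathrm{diag}(\sigma_t)\widehat D^\top$, play the unit vector $y_t=\widehat D[:,j]$ with probability $\sigma_{t,j}$ (expected loss $\mathrm{Tr}(Y_tC_t)$), receive $C_t$, and update $$V_{t+1}=\frac{\exp(\ln Y_t-\eta C_t)}{\mathrm{Tr}\exp(\ln Y_t-\eta C_t)}=\widehat U\mathrm{diag}(v_{t+1})\widehat U^\top,\qquad Y_{t+1}=\widehat U\mathrm{diag}\Big(\frac\alpha n+(1-\alpha)v_{t+1}\Big)\widehat U^\top.$$ Suppose $L>0$ satisfies $\min_{U\in\mathscr{B}^n_1}\sum_{t=r}^s\mathrm{Tr}(UC_t)\le L$ for all $1\le r\le s\le T$, and set $\alpha=\frac1{T+1}$, $D=\ln(n(1+T))+1$, $\eta=\ln(1+\sqrt{2D/L})$. Then $$\mathcal{R}_a^{\mathrm{var\text{-}unit}}:=\max_{[r,s]\subset[1,T]}\Big\{\sum_{t=r}^s\mathrm{Tr}(Y_tC_t)-\min_{U\in\mathscr{B}^n_1}\sum_{t=r}^s\mathrm{Tr}(UC_t)\Big\}\le O(\sqrt{2LD}+D).$$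
   Context: $\ln,\exp$ denote matrix logarithm/exponential. $O(\cdot)$ hides an absolute constant. *)

(* Defs.v *)
From HB Require Import structures.
From mathcomp Require Import all_boot all_order all_algebra.
From mathcomp Require Import all_classical all_reals all_analysis.
Set Implicit Arguments. Unset Strict Implicit. Unset Printing Implicit Defensive.
Import Order.TTheory GRing.Theory Num.Theory.
Local Open Scope ring_scope.
Local Open Scope classical_set_scope.

Section Defs.
Variable R : realType.

Definition symmx n (A : 'M[R]_n) : Prop := A^T = A.

Definition psdmx n (A : 'M[R]_n) : Prop :=
  symmx A /\ forall x : 'cV[R]_n, 0 <= (x^T *m A *m x) 0 0.

Definition loewner_le n (A B : 'M[R]_n) : Prop := psdmx (B - A).

Definition orthomx n (U : 'M[R]_n) : Prop := U^T *m U = 1%:M.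

Definition dens_mx n : set 'M[R]_n :=
  [set Y | psdmx Y /\ \tr Y = 1].

(* Spectral calculus: f(A) := U diag(f(d)) U^T for an eigendecomposition
   A = U diag(d) U^T (U orthogonal), chosen by classical choice; this is
   independent of the chosen decomposition.  Returns 0 when A has no
   such decomposition (never happens for symmetric A). *)
Definition spec_fun n (f : R -> R) (A : 'M[R]_n) : 'M[R]_n :=
  match pselect (exists p : 'M[R]_n * 'rV[R]_n,
                   orthomx p.1 /\ A = p.1 *m diag_mx p.2 *m p.1^T) with
  | left h => let p := projT1 (cid h) in
              p.1 *m diag_mx (map_mx f p.2) *m p.1^T
  | right _ => 0
  end.

(* matrix exponential / logarithm (ln uses MathComp-Analysis' ln, ln 0 = 0) *)
Definition mexp n (A : 'M[R]_n) := spec_fun expR A.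
Definition mlog n (A : 'M[R]_n) := spec_fun (@ln R) A.

Definition fs_step n (eta alpha : R) (Yt Ct Ynext : 'M[R]_n) : Prop :=
  let W := mexp (mlog Yt - eta *: Ct) in
  let V := (\tr W)^-1 *: W in
  exists (U : 'M[R]_n) (v : 'rV[R]_n),
    orthomx U /\ V = U *m diag_mx v *m U^T /\
    Ynext = U *m diag_mx (\row_j (alpha / n%:R + (1 - alpha) * v 0 j)) *m U^T.

Definition best_fixed n (C : nat -> 'M[R]_n) (r s : nat) : R :=
  inf ((fun U : 'M[R]_n => \sum_(r <= t < s.+1) \tr (U *m C t)) @` @dens_mx n).

Definition alg_loss n (Y C : nat -> 'M[R]_n) (r s : nat) : R :=
  \sum_(r <= t < s.+1) \tr (Y t *m C t).

End Defs.
Arguments dens_mx {R} n _.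

(* Main.v *)
(* Let V be the multiplicative update of Y and write S(V||Y) for the relative
   entropy.  Since ln V = ln Y - eta C - z, every density U satisfies
     eta tr(VC) + S(V||Y) = eta tr(UC) + tr(U ln V) - tr(U ln Y).
   The usual appeal to the Golden-Thompson inequality is avoided: with
   X = V^(1/2) and Z = Y^(1/2), the pointwise bound
   a ln(a/b) >= 2a - 2 sqrt(ab) yields S(V||Y) >= |X - Z|_F^2, and positivity of
   tr(((1+eta)X - Z) C ((1+eta)X - Z)) together with C <= 1 turns this into
     eta/(1+eta) tr(YC) <= eta tr(VC) + S(V||Y).
   Mixing with alpha/n costs -ln(1 - alpha) per round and keeps
   ln(alpha/n) <= tr(U ln Y) <= 0, so the sum over an interval telescopes to
   eta/(1+eta) loss <= eta best + D. *)
Require Import Defs.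
From HB Require Import structures.
From mathcomp Require Import all_boot all_order all_algebra.
From mathcomp Require Import all_classical all_reals all_analysis.
From mathcomp Require Import complex ring lra zify.
Import Order.TTheory GRing.Theory Num.Theory.
Local Open Scope ring_scope.
Set Implicit Arguments.
Unset Strict Implicit.
Unset Printing Implicit Defensive.

(* [spectral.v] also defines an [orthomx]. *)
Local Notation orthomx := Defs.orthomx.

(** * The real spectral theorem *)

Section SpectralTheorem.
Variable R : realType.

Lemma trmx_mul_self_ge0 n (v : 'cV[R]_n) : 0 <= (v^T *m v) 0 0.
Proof.
by rewrite mxE sumr_ge0// => i _; rewrite mxE -expr2 sqr_ge0.
Qed.

Lemma trmx_mul_self_eq0 n (v : 'cV[R]_n) : ((v^T *m v) 0 0 == 0) = (v == 0).
Proof.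
apply/eqP/eqP => [|->]; last by rewrite mulmx0 mxE.
rewrite mxE => /eqP; rewrite psumr_eq0; last first.
  by move=> i _; rewrite mxE -expr2 sqr_ge0.
move=> /allP v0; apply/matrixP => i j; rewrite ord1 mxE.
have := v0 i (mem_index_enum i); rewrite mxE /= mulf_eq0 orbb.
by move/eqP.
Qed.

(** Over the complex numbers A becomes Hermitian, so its spectral values are real, and a real
    eigenvalue of the complexified matrix is already one of A. *)
Lemma symmx_eigenvalue n (A : 'M[R]_n.+1) :
  symmx A -> exists a, eigenvalue A a.
Proof.
move=> symA; pose B := map_mx (real_complex R) A.
have hermB : B \is hermsymmx.
  apply: realsym_hermsym.
    apply/is_hermitianmxP; rewrite expr0 scale1r map_mx_id//.
    by apply/matrixP => i j; rewrite !mxE -[in LHS]symA mxE.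
  by apply/mxOverP => i j; rewrite mxE /= complex_real.
have /orthomx_spectralP specB := hermitian_normalmx hermB.
have /mxOverP/(_ 0 0) reala := hermitian_spectral_diag_real hermB.
exists (complex.Re (spectral_diag B 0 0)).
rewrite -(eigenvalue_map (real_complex R)) -/B /= RRe_real//.
apply/eigenvalueP; exists (row 0 (spectralmx B)).
  rewrite -row_mul {2}specB !mulmxA mulmxV ?spectral_unit// mul1mx.
  by apply/rowP => j; rewrite mul_diag_mx !mxE.
apply: contraTneq (spectral_unit B) => row0.
rewrite unitmxE (expand_det_row _ 0) big1 ?unitr0// => j _.
by move/rowP: row0 => /(_ j); rewrite !mxE => ->; rewrite mul0r.
Qed.

Lemma orthomx_with_col n (u : 'cV[R]_n.+1) :
  (u^T *m u) 0 0 = 1 -> exists2 Q : 'M[R]_n.+1, orthomx Q & col 0 Q = u.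
Proof.
move=> u1; pose e : 'cV[R]_n.+1 := delta_mx 0 0.
have [ue|/negPf une] := eqVneq u e.
  by exists 1%:M; [rewrite /orthomx trmx1 mulmx1|rewrite ue col1].
(* [Q] is the Householder reflection exchanging [e] and [u]. *)
pose w := u - e; pose c := (w^T *m w) 0 0.
have cN0 : c != 0 by rewrite /c trmx_mul_self_eq0 subr_eq0 une.
have ue0 : (e^T *m u) 0 0 = u 0 0.
  by rewrite /e trmx_delta -rowE mxE.
have eu0 : (u^T *m e) 0 0 = u 0 0.
  by rewrite -[in LHS](trmxK e) -trmx_mul mxE ue0.
have ee : (e^T *m e) 0 0 = 1 by rewrite /e trmx_delta -rowE !mxE !eqxx.
have wT : w^T = u^T - e^T by rewrite linearB.
have mxB (X Y : 'M[R]_1) : (X - Y) 0 0 = X 0 0 - Y 0 0 by rewrite !mxE.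
have cE : c = 2 * (1 - u 0 0).
  rewrite /c wT mulmxBl /w !mulmxBr !mxB.
  by rewrite u1 ee ue0 eu0; ring.
have wwE : w^T *m w = c%:M by rewrite [LHS]mx11_scalar.
pose P := w *m w^T; have PP : P *m P = c *: P.
  by rewrite /P mulmxA -(mulmxA w) wwE mul_mx_scalar scalemxAl.
pose t := 2 / c; have tt : t * t * c = t + t by rewrite /t; field.
pose Q := 1%:M - t *: P.
have QT : Q^T = Q.
  by rewrite /Q linearB linearZ /= trmx1 /P trmx_mul trmxK.
exists Q.
  rewrite /Defs.orthomx QT /Q mulmxBl mul1mx mulmxBr mulmx1.
  rewrite -scalemxAl -scalemxAr PP !scalerA tt scalerDl.
  by rewrite opprB addrK subrK.
rewrite colE -/e /Q mulmxBl mul1mx -scalemxAl /P -mulmxA.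
(* As u and e are unit vectors, w pairs with e to -c/2, so Q moves e by exactly w. *)
have -> : w^T *m e = (- (c / 2))%:M.
  rewrite [LHS]mx11_scalar wT mulmxBl mxB.
  by congr (_%:M); rewrite eu0 ee cE; field.
rewrite mul_mx_scalar scalerA (_ : t * - _ = -1) ?scaleN1r; last first.
  by rewrite /t; field.
by rewrite opprK /w addrC subrK.
Qed.

Lemma orthomx_mul n (P Q : 'M[R]_n) :
  orthomx P -> orthomx Q -> orthomx (P *m Q).
Proof.
by move=> oP oQ; rewrite /Defs.orthomx trmx_mul mulmxA -(mulmxA Q^T) oP mulmx1.
Qed.

Lemma orthomx_trV n (P : 'M[R]_n) : orthomx P -> P *m P^T = 1%:M.
Proof. exact: mulmx1C. Qed.

(** Deflation: conjugating by an orthogonal Q whose first column is a unit eigenvector clears the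
    first column below the diagonal, symmetry clears the first row, and induction treats the
    remaining block. *)
Theorem spectral_theorem n (A : 'M[R]_n) : symmx A ->
  exists (P : 'M[R]_n) (d : 'rV[R]_n),
    orthomx P /\ A = P *m diag_mx d *m P^T.
Proof.
elim: n A => [A _|n IHn A symA].
  exists 1%:M, 0; split; first by rewrite /Defs.orthomx trmx1 mulmx1.
  by apply/matrixP => -[].
have [a /eigenvalueP[v vA v0]] := symmx_eigenvalue symA.
pose r := (v *m v^T) 0 0.
have r_gt0 : 0 < r.
  rewrite /r -[X in X *m _]trmxK lt_def trmx_mul_self_ge0 andbT.
  by rewrite trmx_mul_self_eq0 trmx_eq0.
pose u := (Num.sqrt r)^-1 *: v^T.
have uT : u^T = (Num.sqrt r)^-1 *: v by rewrite /u linearZ /= trmxK.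
have u1 : (u^T *m u) 0 0 = 1.
  rewrite uT /u -scalemxAl -scalemxAr scalerA mxE -/r.
  by rewrite -invfM -expr2 sqr_sqrtr ?ltW// mulVf// gt_eqF.
have Au : A *m u = a *: u.
  rewrite /u -scalemxAr -[X in X *m _]symA -trmx_mul vA.
  by rewrite linearZ /= !scalerA mulrC.
have [Q oQ Qu] := orthomx_with_col u1.
pose B := Q^T *m A *m Q.
have symB : B^T = B by rewrite /B !trmx_mul trmxK symA mulmxA.
have Qe : Q *m delta_mx 0 0 = u by rewrite -colE.
have Be : B *m delta_mx 0 0 = a *: delta_mx 0 0 :> 'cV_n.+1.
  by rewrite /B -!mulmxA Qe Au -scalemxAr -Qe mulmxA oQ mul1mx.
have B0 i : B i 0 = a *+ (i == 0).
  have /colP/(_ i) := Be; rewrite -colE mxE => ->.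
  by rewrite !mxE eqxx andbT mulr_natr.
have l0 : lshift n (0 : 'I_1) = 0 :> 'I_n.+1 by exact/val_inj.
have Bblock : B =
  block_mx a%:M 0 0 (drsubmx (B : 'M[R]_(1 + n))) :> 'M[R]_(1 + n).
  rewrite -[LHS](@submxK _ 1 n 1 n); congr block_mx; apply/matrixP => i j.
  - by rewrite mxE [LHS]mxE !ord1 l0 B0 mxE.
  - by rewrite mxE [LHS]mxE -[in LHS]symB mxE !ord1 l0 B0 mxE.
  - by rewrite mxE [LHS]mxE !ord1 l0 B0 mxE.
have [|P [d [oP BE]]] := IHn (drsubmx (B : 'M[R]_(1 + n))).
  by rewrite /symmx trmx_drsub symB.
pose P1 : 'M[R]_(1 + n) := block_mx 1%:M 0 0 P.
have oP1 : P1^T *m P1 = 1%:M.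
  rewrite /P1 tr_block_mx mulmx_block !trmx0 trmx1.
  by rewrite !(mulmx0, mul0mx, mulmx1, addr0, add0r) oP -scalar_mx_block.
have BE1 : B = P1 *m diag_mx (row_mx a%:M d) *m P1^T.
  rewrite Bblock BE /P1 tr_block_mx diag_mx_row !mulmx_block.
  rewrite !trmx0 trmx1 !(mulmx0, mul0mx, mulmx1, mul1mx, addr0, add0r).
  suff -> : diag_mx (a%:M : 'rV[R]_1) = a%:M by [].
  by apply/matrixP => i j; rewrite !mxE !ord1.
exists (Q *m P1), (row_mx a%:M d); split; first exact: orthomx_mul.
have -> : A = Q *m B *m Q^T.
  by rewrite /B !mulmxA orthomx_trV// mul1mx -mulmxA orthomx_trV// mulmx1.
by rewrite BE1 trmx_mul !mulmxA.
Qed.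

End SpectralTheorem.

(** * Functional calculus and traces in an eigenbasis *)

Section SpectralCalculus.
Variable R : realType.

(** The eigenvalues form a function rather than a row vector, so that applying a scalar function is
    plain composition. *)
Definition spec_mx n (P : 'M[R]_n) (d : 'I_n -> R) : 'M[R]_n :=
  P *m diag_mx (\row_j d j) *m P^T.

Lemma spectral_symmx n (A : 'M[R]_n) : symmx A ->
  exists P d, orthomx P /\ A = spec_mx P d.
Proof.
move=> /spectral_theorem[P [d [oP AE]]]; exists P, (d 0); split=> //.
by rewrite AE; congr (_ *m diag_mx _ *m _); apply/rowP => j; rewrite mxE.
Qed.

Lemma eq_spec_mx n (P : 'M[R]_n) d1 d2 :
  d1 =1 d2 -> spec_mx P d1 = spec_mx P d2.
Proof. by move=> /funext ->. Qed.

Lemma spec_mx_sym n (P : 'M[R]_n) d : symmx (spec_mx P d).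
Proof. by rewrite /symmx /spec_mx !trmx_mul trmxK tr_diag_mx mulmxA. Qed.

Lemma spec_mxD n (P : 'M[R]_n) d1 d2 :
  spec_mx P (fun i => d1 i + d2 i) = spec_mx P d1 + spec_mx P d2.
Proof.
rewrite /spec_mx -mulmxDl -mulmxDr -linearD /=.
by congr (_ *m diag_mx _ *m _); apply/rowP => j; rewrite !mxE.
Qed.

Lemma spec_mxZ n (P : 'M[R]_n) c d :
  spec_mx P (fun i => c * d i) = c *: spec_mx P d.
Proof.
rewrite /spec_mx scalemxAl scalemxAr -linearZ /=.
by congr (_ *m diag_mx _ *m _); apply/rowP => j; rewrite !mxE.
Qed.

Lemma spec_mx_cst n (P : 'M[R]_n) c : orthomx P -> spec_mx P (fun=> c) = c%:M.
Proof.
move=> oP; rewrite /spec_mx (_ : diag_mx _ = c%:M); last first.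
  by apply/matrixP => i j; rewrite !mxE.
by rewrite -scalemx1 -scalemxAr mulmx1 -scalemxAl orthomx_trV.
Qed.

Lemma spec_mxM n (P : 'M[R]_n) d1 d2 : orthomx P ->
  spec_mx P d1 *m spec_mx P d2 = spec_mx P (fun i => d1 i * d2 i).
Proof.
move=> oP; rewrite /spec_mx -!mulmxA (mulmxA P^T) oP mul1mx.
rewrite (mulmxA (diag_mx _)) mulmx_diag.
by congr (_ *m (diag_mx _ *m _)); apply/rowP => j; rewrite !mxE.
Qed.

Lemma mxtrace_mul_spec n (U P : 'M[R]_n) d :
  \tr (U *m spec_mx P d) = \sum_i (P^T *m U *m P) i i * d i.
Proof.
rewrite /spec_mx !mulmxA mxtrace_mulC !mulmxA mul_mx_diag.
by apply: eq_bigr => i _; rewrite !mxE.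
Qed.

Lemma mxtrace_spec n (P : 'M[R]_n) d : orthomx P ->
  \tr (spec_mx P d) = \sum_i d i.
Proof.
move=> oP; rewrite -[spec_mx P d]mul1mx mxtrace_mul_spec mulmx1 oP.
by apply: eq_bigr => i _; rewrite mxE eqxx mul1r.
Qed.

(** The squared overlaps of the two eigenbases are nonnegative weights, so a trace inequality
    between non-commuting matrices reduces to a scalar one for each pair of eigenvalues. *)
Lemma mxtrace_spec_mul_spec n (P Q : 'M[R]_n) d e :
  \tr (spec_mx P d *m spec_mx Q e) =
  \sum_i \sum_j ((P^T *m Q) i j) ^+ 2 * (d i * e j).
Proof.
rewrite mxtrace_mul_spec exchange_big /=; apply: eq_bigr => j _.
rewrite /spec_mx !mulmxA -!mulmxA (mulmxA Q^T) mulmxA.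
rewrite -[Q^T *m P]trmxK trmx_mul trmxK; set K := P^T *m Q.
rewrite mxE mulr_suml; apply: eq_bigr => i _.
by rewrite mul_mx_diag !mxE; ring.
Qed.

(** A nonzero entry [K i j] forces e_i = d_j, hence f(e_i) = f(d_j); zero entries impose nothing. *)
Lemma diag_mx_intertwine n (K : 'M[R]_n) (d e : 'rV[R]_n) (f : R -> R) :
  diag_mx e *m K = K *m diag_mx d ->
  diag_mx (map_mx f e) *m K = K *m diag_mx (map_mx f d).
Proof.
rewrite !mul_diag_mx !mul_mx_diag => /matrixP KE.
apply/matrixP => i j; move: (KE i j); rewrite !mxE.
have [->|K0] := eqVneq (K i j) 0; first by rewrite !(mulr0, mul0r).
by rewrite mulrC => /(mulfI K0) ->; rewrite mulrC.
Qed.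

(** The decomposition chosen inside [spec_fun] and the given one are related by K = Q^T P, which
    intertwines their diagonals and therefore also the images under f. *)
Lemma spec_funE n (P : 'M[R]_n) d (f : R -> R) : orthomx P ->
  spec_fun f (spec_mx P d) = spec_mx P (f \o d).
Proof.
move=> oP; rewrite /spec_fun; case: pselect => [h|]; last first.
  by case; exists (P, \row_j d j).
case: (cid h) => -[Q e] /= [oQ PQ].
pose K := Q^T *m P.
have KE : diag_mx e *m K = K *m diag_mx (\row_j d j).
  have := congr1 (fun M => Q^T *m M *m P) PQ.
  rewrite /spec_mx !mulmxA oQ mul1mx -!mulmxA oP mulmx1 => <-.
  by rewrite /K !mulmxA.
have fKE := diag_mx_intertwine f KE.
have -> : Q^T = K *m P^T by rewrite /K -mulmxA orthomx_trV// mulmx1.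
rewrite -mulmxA (mulmxA (diag_mx _)) fKE /K !mulmxA orthomx_trV// mul1mx.
by congr (_ *m diag_mx _ *m _); apply/rowP => j; rewrite !mxE.
Qed.

Lemma spec_fun_sym n (A : 'M[R]_n) (f : R -> R) : symmx (spec_fun f A).
Proof.
rewrite /spec_fun; case: pselect => [h|_]; last by rewrite /symmx trmx0.
by rewrite /symmx !trmx_mul trmxK tr_diag_mx mulmxA.
Qed.

Lemma psdmx_diag_ge0 n m (A : 'M[R]_n) (X : 'M[R]_(n, m)) i :
  psdmx A -> 0 <= (X^T *m A *m X) i i.
Proof.
move=> [_ /(_ (X *m delta_mx i 0))]; rewrite trmx_mul trmx_delta !mulmxA.
by rewrite -colE mxE -!mulmxA -rowE mxE.
Qed.

Lemma mxtrace_psd_ge0 n m (A : 'M[R]_n) (X : 'M[R]_(n, m)) :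
  psdmx A -> 0 <= \tr (X^T *m A *m X).
Proof. by move=> psdA; apply: sumr_ge0 => i _; exact: psdmx_diag_ge0. Qed.

Lemma ler_mxtrace_spec n (U P : 'M[R]_n) d e : psdmx U ->
  (forall i, d i <= e i) -> \tr (U *m spec_mx P d) <= \tr (U *m spec_mx P e).
Proof.
move=> psdU de; rewrite !mxtrace_mul_spec; apply: ler_sum => i _.
by rewrite ler_wpM2l// psdmx_diag_ge0.
Qed.

Lemma mxtrace_mul_psd_ge0 n (A B : 'M[R]_n) :
  psdmx A -> psdmx B -> 0 <= \tr (A *m B).
Proof.
move=> psdA psdB; have [P [d [oP BE]]] := spectral_symmx psdB.1.
rewrite BE mxtrace_mul_spec; apply: sumr_ge0 => i _.
rewrite mulr_ge0 ?psdmx_diag_ge0//.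
have := psdmx_diag_ge0 P i psdB; rewrite BE /spec_mx !mulmxA oP mul1mx.
by rewrite -mulmxA oP mulmx1 !mxE eqxx.
Qed.

End SpectralCalculus.

(** * One multiplicative update, before mixing *)

Section OneRound.
Variable R : realType.

(** This is ln x <= x - 1 at x = sqrt(b) / sqrt(a), multiplied by -2a. *)
Lemma mul_ln_sub_ge (a b : R) : 0 < a -> 0 < b ->
  2 * (a - Num.sqrt a * Num.sqrt b) <= a * (ln a - ln b).
Proof.
move=> a0 b0; pose s := Num.sqrt a; pose r := Num.sqrt b.
have s0 : 0 < s by rewrite sqrtr_gt0.
have r0 : 0 < r by rewrite sqrtr_gt0.
have aE : a = s ^+ 2 by rewrite sqr_sqrtr// ltW.
have bE : b = r ^+ 2 by rewrite sqr_sqrtr// ltW.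
rewrite -/s -/r aE bE !lnXn//.
have : ln (1 + (r / s - 1)) <= r / s - 1.
  by apply: le_ln1Dx; rewrite -subr_gt0 opprK subrK divr_gt0.
rewrite addrC subrK ln_div ?posrE// => h.
have : s ^+ 2 * (ln r - ln s) <= s * r - s ^+ 2.
  rewrite (_ : s * r - s ^+ 2 = s ^+ 2 * (r / s - 1)); last first.
    by field; rewrite gt_eqF.
  by rewrite ler_wpM2l// sqr_ge0.
move: (ln s) (ln r) => ls lr.
rewrite (_ : _ * (ls *+ 2 - _) = - 2 * (s ^+ 2 * (lr - ls))); last by ring.
by move: (_ * (lr - _)) => x; lra.
Qed.

(* The right-hand side is the squared Frobenius distance between the square
   roots of the two matrices; it replaces the Golden-Thompson inequality. *)
Lemma relative_entropy_ge n (P Q : 'M[R]_n) (a b : 'I_n -> R) :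
  orthomx P -> orthomx Q -> (forall i, 0 < a i) -> (forall i, 0 < b i) ->
  2 * (\tr (spec_mx P a) -
       \tr (spec_mx P (Num.sqrt \o a) *m spec_mx Q (Num.sqrt \o b))) <=
  \tr (spec_mx P a *m (spec_mx P (@ln R \o a) - spec_mx Q (@ln R \o b))).
Proof.
move=> oP oQ a0 b0.
(* The identity is written in the eigenbasis Q, so that every trace becomes a double sum with the
   same overlap weights. *)
have -> : \tr (spec_mx P a) = \tr (spec_mx P a *m spec_mx Q (fun=> 1)).
  by rewrite spec_mx_cst// mulmx1.
have -> : spec_mx P a *m (spec_mx P (@ln R \o a) - spec_mx Q (@ln R \o b)) =
  spec_mx P (fun i => a i * ln (a i)) *m spec_mx Q (fun=> 1)
  - spec_mx P a *m spec_mx Q (@ln R \o b).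
  by rewrite mulmxBr spec_mxM// spec_mx_cst// mulmx1.
rewrite linearB /= !mxtrace_spec_mul_spec -!sumrB mulr_sumr.
apply: ler_sum => i _; rewrite -!sumrB mulr_sumr; apply: ler_sum => j _.
rewrite -!mulrBr mulrCA ler_wpM2l ?sqr_ge0// !mulr1 -mulrBr.
exact: mul_ln_sub_ge.
Qed.

(** By the normalizations, 2(1 - tr(XZ)) is the squared Frobenius norm of X - Z, which dominates
    tr((X - Z)C(X - Z)) since C <= 1. The cross terms of the latter are at most (1 + eta) tr(XXC) +
    tr(ZZC) / (1 + eta), by positivity of C tested on (1 + eta)X - Z. *)
Lemma mxtrace_loss_transfer n (C X Z : 'M[R]_n) (eta : R) : 0 < eta ->
  loewner_le 0 C -> loewner_le C 1%:M -> symmx X -> symmx Z ->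
  \tr (X *m X) = 1 -> \tr (Z *m Z) = 1 ->
  eta / (1 + eta) * \tr (Z *m Z *m C) <=
  eta * \tr (X *m X *m C) + 2 * (1 - \tr (X *m Z)).
Proof.
move=> eta0; rewrite /loewner_le subr0 => C0 C1 symX symZ X1 Z1.
have symXZ (x z : R) : (x *: X + z *: Z)^T = x *: X + z *: Z.
  by rewrite linearD !linearZ /= symX symZ.
have trE (x z : R) (A : 'M[R]_n) :
  \tr ((x *: X + z *: Z)^T *m A *m (x *: X + z *: Z)) =
  x ^+ 2 * \tr (X *m A *m X) + z ^+ 2 * \tr (Z *m A *m Z)
  + x * z * (\tr (X *m A *m Z) + \tr (Z *m A *m X)).
  rewrite symXZ !mulmxDl !mulmxDr -!scalemxAl -!scalemxAr.
  by rewrite !linearD !linearZ /=; ring.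
have trC (A B : 'M[R]_n) : \tr (A *m B *m A) = \tr (A *m A *m B).
  by rewrite mxtrace_mulC mulmxA.
have tr1B (A B : 'M[R]_n) :
  \tr (A *m (1%:M - C) *m B) = \tr (A *m B) - \tr (A *m C *m B).
  by rewrite mulmxBr mulmx1 mulmxBl linearB.
have := mxtrace_psd_ge0 ((1 + eta) *: X + (-1) *: Z) C0.
have := mxtrace_psd_ge0 (1 *: X + (-1) *: Z) C1.
rewrite !trE !tr1B !trC X1 Z1.
rewrite [\tr (Z *m X)]mxtrace_mulC.
move: (\tr (X *m C *m Z)) (\tr (Z *m C *m X)) => m1 m2.
move: (\tr (X *m X *m C)) (\tr (Z *m Z *m C)) (\tr (X *m Z)) => s q f h1 h2.
have e1 : 0 < 1 + eta by rewrite addr_gt0.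
have h3 : (m1 + m2) - (1 + eta) * s <= q / (1 + eta).
  by rewrite ler_pdivlMr//; nra.
rewrite (_ : eta / (1 + eta) * q = q - q / (1 + eta)); last first.
  by field; rewrite gt_eqF.
lra.
Qed.

(** Here z is the logarithm of the partition function tr exp(H), positive because the dimension is
    nonzero. *)
Lemma mexp_normalized n (H : 'M[R]_n.+1) : symmx H ->
  exists (P : 'M[R]_n.+1) (a : 'I_n.+1 -> R) (z : R),
  [/\ orthomx P, (forall i, 0 < a i), \sum_i a i = 1,
      (\tr (mexp H))^-1 *: mexp H = spec_mx P a
    & spec_mx P (@ln R \o a) = H - z%:M].
Proof.
move=> /spectral_symmx[P [h [oP HE]]].
pose Z := \sum_i expR (h i).
have Z0 : 0 < Z.
  rewrite /Z big_ord_recl ltr_pwDl ?expR_gt0//.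
  by apply: sumr_ge0 => i _; exact: expR_ge0.
exists P, (fun i => Z^-1 * expR (h i)), (ln Z); split => //.
- by move=> i; rewrite mulr_gt0 ?invr_gt0 ?expR_gt0.
- by rewrite -mulr_sumr mulVf ?gt_eqF.
- by rewrite /mexp HE spec_funE// mxtrace_spec// -spec_mxZ.
- rewrite HE -(spec_mx_cst (ln Z) oP) -scaleN1r -spec_mxZ -spec_mxD.
  apply: eq_spec_mx => i /=; rewrite lnM ?posrE ?invr_gt0 ?expR_gt0//.
  by rewrite expRK lnV ?posrE// mulN1r addrC.
Qed.

(** As ln V - ln Y = -eta C - z, the right-hand side equals -z for every U of trace one. The same
    identity at V gives -z = eta tr(VC) + S(V||Y), where the entropy is bounded below through the
    square roots of V and Y. *)
Lemma multiplicative_update n (C Q U : 'M[R]_n.+1) (b : 'I_n.+1 -> R)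
    (eta : R) :
  0 < eta -> symmx C -> loewner_le 0 C -> loewner_le C 1%:M ->
  orthomx Q -> (forall i, 0 < b i) -> \sum_i b i = 1 ->
  let Y := spec_mx Q b in
  let W := mexp (mlog Y - eta *: C) in
  let V := (\tr W)^-1 *: W in \tr U = 1 ->
  eta / (1 + eta) * \tr (Y *m C) <=
  eta * \tr (U *m C) + \tr (U *m mlog V) - \tr (U *m mlog Y).
Proof.
move=> eta0 symC C0 C1 oQ b0 b1 Y W V U1.
have symH : symmx (mlog Y - eta *: C).
  by rewrite /symmx linearB linearZ /= symC spec_fun_sym.
have [P [a [z [oP a0 a1 VE lnVE]]]] := mexp_normalized symH.
have mlogV : mlog V = mlog Y - eta *: C - z%:M.
  by rewrite /V /W VE /mlog spec_funE.
have relE (M : 'M[R]_n.+1) : \tr M = 1 ->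
    \tr (M *m (mlog V - mlog Y)) = - eta * \tr (M *m C) - z.
  move=> M1; rewrite mlogV (_ : _ - _ = (- eta) *: C - z%:M); last first.
    by rewrite scaleNr addrC addrA addKr.
  rewrite mulmxBr linearB /= -scalemxAr linearZ /=.
  by rewrite mul_mx_scalar linearZ /= M1 mulr1.
have := relE U U1; rewrite mulmxBr linearB /= => relU.
have V1 : \tr V = 1 by rewrite /V /W VE mxtrace_spec.
have relV := relE V V1.
have sqrtM (T : 'M[R]_n.+1) d : orthomx T -> (forall i, 0 < d i) ->
    spec_mx T (Num.sqrt \o d) *m spec_mx T (Num.sqrt \o d) = spec_mx T d.
  move=> oT d0; rewrite spec_mxM//; apply: eq_spec_mx => i /=.
  by rewrite -expr2 sqr_sqrtr// ltW.
have := relative_entropy_ge oP oQ a0 b0.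
rewrite -VE -/W -/V V1 -(spec_funE _ _ oP) -(spec_funE _ _ oQ) -VE -/Y -/W -/V.
rewrite -/(mlog V) -/(mlog Y) relV => ent.
have := @mxtrace_loss_transfer _ C (spec_mx P (Num.sqrt \o a))
  (spec_mx Q (Num.sqrt \o b)) eta eta0 C0 C1
  (spec_mx_sym _ _) (spec_mx_sym _ _).
rewrite !sqrtM// !mxtrace_spec// => /(_ a1 b1).
rewrite -VE -/W -/V -/Y => tra.
lra.
Qed.

End OneRound.

(** * Mixing with the uniform density and telescoping over an interval *)

Section Mixing.
Variable R : realType.

(** For mu > 0 this describes densities bounded away from singular ones, where [mlog] never meets
    the default value of [ln] at 0. *)
Definition mixed n (mu : R) (Y : 'M[R]_n) :=
  exists (P : 'M[R]_n) (b : 'I_n -> R),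
  [/\ orthomx P, Y = spec_mx P b, (forall i, mu <= b i) & \sum_i b i = 1].

(** With the next bound this confines the potential tr(U ln Y) to [ln mu, 0], so telescoping over
    any interval costs at most -ln mu. *)
Lemma mxtrace_mlog_mixed_ge n (mu : R) (U Y : 'M[R]_n) :
  0 < mu -> dens_mx n U -> mixed mu Y -> ln mu <= \tr (U *m mlog Y).
Proof.
move=> mu0 [psdU U1] [P [b [oP -> bmu b1]]]; rewrite /mlog spec_funE//.
rewrite -[leLHS]mulr1 -{1}U1 -linearZ /= -mul_mx_scalar -(spec_mx_cst _ oP).
apply: ler_mxtrace_spec => // i /=.
by rewrite ler_ln ?posrE// (lt_le_trans mu0).
Qed.

Lemma mxtrace_mlog_mixed_le0 n (mu : R) (U Y : 'M[R]_n) :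
  0 < mu -> dens_mx n U -> mixed mu Y -> \tr (U *m mlog Y) <= 0.
Proof.
move=> mu0 [psdU U1] [P [b [oP -> bmu b1]]]; rewrite /mlog spec_funE//.
rewrite [leRHS](_ : _ = \tr (U *m spec_mx P (fun=> 0))); last first.
  by rewrite spec_mx_cst// mul_mx_scalar scale0r mxtrace0.
apply: ler_mxtrace_spec => // i /=.
apply: ln_le0; rewrite -b1 (bigD1 i)//= lerDl sumr_ge0// => j _.
by rewrite (le_trans (ltW mu0)).
Qed.

(** The mixed matrix is (alpha/n) I + (1 - alpha) V whatever eigenbasis of V the step used, so the
    basis from [mexp_normalized] can replace it. *)
Lemma fs_step_spec n (eta alpha : R) (Y C Y' : 'M[R]_n.+1) :
  symmx C -> fs_step eta alpha Y C Y' ->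
  exists (P : 'M[R]_n.+1) (a : 'I_n.+1 -> R),
  let W := mexp (mlog Y - eta *: C) in
  [/\ orthomx P, (forall i, 0 < a i), \sum_i a i = 1,
    (\tr W)^-1 *: W = spec_mx P a &
    Y' = spec_mx P (fun i => alpha / n.+1%:R + (1 - alpha) * a i)].
Proof.
move=> symC [Q [v [oQ [VE ->]]]].
have symH : symmx (mlog Y - eta *: C).
  by rewrite /symmx linearB linearZ /= symC spec_fun_sym.
have [P [a [z [oP a0 a1 VP _]]]] := mexp_normalized symH.
exists P, a; split=> //.
rewrite spec_mxD spec_mx_cst// spec_mxZ -VP VE -(spec_mx_cst _ oQ).
have -> : Q *m diag_mx v *m Q^T = spec_mx Q (v 0).
  by congr (_ *m diag_mx _ *m _); apply/rowP => j; rewrite mxE.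
by rewrite -spec_mxZ -spec_mxD.
Qed.

Lemma fs_step_mixed n (eta alpha : R) (Y C Y' : 'M[R]_n.+1) :
  0 < alpha <= 1 -> symmx C -> fs_step eta alpha Y C Y' ->
  mixed (alpha / n.+1%:R) Y'.
Proof.
move=> /andP[al0 al1] symC /(fs_step_spec symC)[P [a [oP a0 a1 _ Y'E]]].
exists P, (fun i => alpha / n.+1%:R + (1 - alpha) * a i); split=> // [i|].
  by rewrite lerDl mulr_ge0 ?subr_ge0// ltW.
rewrite big_split /= sumr_const -mulr_sumr a1 card_ord -[_ *+ _]mulr_natr.
by rewrite divfK ?pnatr_eq0//; ring.
Qed.

Lemma fs_step_regret n (eta alpha mu : R) (Y C Y' U : 'M[R]_n.+1) :
  0 < eta -> 0 < alpha < 1 -> 0 < mu -> symmx C ->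
  loewner_le 0 C -> loewner_le C 1%:M -> mixed mu Y -> dens_mx n.+1 U ->
  fs_step eta alpha Y C Y' ->
  eta / (1 + eta) * \tr (Y *m C) <=
  eta * \tr (U *m C) + (\tr (U *m mlog Y') - \tr (U *m mlog Y))
  - ln (1 - alpha).
Proof.
move=> eta0 /andP[al0 al1] mu0 symC C0 C1 [Q [b [oQ YE bmu b1]]] [psdU U1].
move=> /(fs_step_spec symC)[P [a [oP a0 a1 VE Y'E]]].
have b0 i : 0 < b i by rewrite (lt_le_trans mu0).
have := multiplicative_update eta0 symC C0 C1 oQ b0 b1 U1.
rewrite -YE VE /= => upd.
(* V and Y' share the eigenbasis P, so this is monotonicity of [ln] applied to alpha/n + (1 - alpha)
   a_i >= (1 - alpha) a_i. *)
have mixing :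
  \tr (U *m mlog (spec_mx P a)) + ln (1 - alpha) <= \tr (U *m mlog Y').
  have -> : ln (1 - alpha) = \tr (U *m spec_mx P (fun=> ln (1 - alpha))).
    by rewrite spec_mx_cst// mul_mx_scalar linearZ /= U1 mulr1.
  rewrite -linearD /= -mulmxDr Y'E /mlog !spec_funE// -spec_mxD.
  apply: ler_mxtrace_spec => // i /=.
  have al1' : 0 < 1 - alpha by rewrite subr_gt0.
  have aa0 : 0 < (1 - alpha) * a i by rewrite mulr_gt0.
  rewrite addrC -lnM ?posrE// ler_ln ?posrE//.
    by rewrite lerDr divr_ge0// ltW.
  by rewrite ltr_wpDl// divr_ge0// ltW.
move: (ln _) mixing => l mixing; lra.
Qed.

(** Ensures that [best_fixed] is an infimum over a nonempty set. *)
Lemma dens_mx_nonempty n : exists U : 'M[R]_n.+1, dens_mx n.+1 U.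
Proof.
exists (n.+1%:R^-1)%:M; split; last first.
  by rewrite mxtrace_scalar -[LHS]mulr_natr mulVf ?pnatr_eq0.
split; first by rewrite /symmx tr_scalar_mx.
move=> x; rewrite mul_mx_scalar -scalemxAl mxE mulr_ge0 ?invr_ge0 ?ler0n//.
exact: trmx_mul_self_ge0.
Qed.

Lemma le_best_fixed n (C : nat -> 'M[R]_n.+1) r s x :
  (forall U, dens_mx n.+1 U -> x <= \sum_(r <= t < s.+1) \tr (U *m C t)) ->
  x <= best_fixed C r s.
Proof.
move=> xU; apply: lb_le_inf.
  by have [U dU] := dens_mx_nonempty n; eexists; exists U.
by move=> _ [U dU <-]; exact: xU.
Qed.

(** Positive losses bound the set below by 0, so that [inf] is a genuine infimum and not a default
    value. *)
Lemma best_fixed_le n (C : nat -> 'M[R]_n.+1) r s (U : 'M[R]_n.+1) :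
  (forall t, (r <= t <= s)%N -> loewner_le 0 (C t)) -> dens_mx n.+1 U ->
  best_fixed C r s <= \sum_(r <= t < s.+1) \tr (U *m C t).
Proof.
move=> C0 dU; apply: ge_inf; last by exists U.
exists 0 => _ [U' [psdU' _] <-]; rewrite big_nat; apply: sumr_ge0 => t rts.
have := C0 t rts; rewrite /loewner_le subr0.
exact: mxtrace_mul_psd_ge0.
Qed.

Lemma interval_regret n (eta alpha : R) (C Y : nat -> 'M[R]_n.+1) T r s
    (U : 'M[R]_n.+1) :
  0 < eta -> 0 < alpha < 1 ->
  (forall t, (1 <= t <= T)%N ->
    symmx (C t) /\ loewner_le 0 (C t) /\ loewner_le (C t) 1%:M) ->
  (forall t, (1 <= t <= T)%N -> fs_step eta alpha (Y t) (C t) (Y t.+1)) ->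
  dens_mx n.+1 U -> (2 <= r)%N -> (r <= s)%N -> (s <= T)%N ->
  eta / (1 + eta) * alg_loss Y C r s <=
  eta * \sum_(r <= t < s.+1) \tr (U *m C t)
  - ln (alpha / n.+1%:R) - (s.+1 - r)%:R * ln (1 - alpha).
Proof.
move=> eta0 al Cok Ystep dU r2 rs sT; have /andP[al0 al1] := al.
have mu0 : 0 < alpha / n.+1%:R by rewrite divr_gt0.
(* Only outputs of a step are mixed, and [Y 1] is not one; hence the restriction to r >= 2. *)
have Ymix t : (2 <= t <= T.+1)%N -> mixed (alpha / n.+1%:R) (Y t).
  case: t => [//|t] tT; have t1 : (1 <= t <= T)%N by lia.
  by apply: fs_step_mixed (Cok t t1).1 (Ystep t t1); rewrite al0 ltW.
rewrite /alg_loss mulr_sumr.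
have step t : (r <= t < s.+1)%N -> eta / (1 + eta) * \tr (Y t *m C t) <=
  eta * \tr (U *m C t) + (\tr (U *m mlog (Y t.+1)) - \tr (U *m mlog (Y t)))
  - ln (1 - alpha).
  move=> rts; have t1 : (1 <= t <= T)%N by lia.
  have [symC [C0 C1]] := Cok t t1.
  apply: fs_step_regret eta0 al mu0 symC C0 C1 _ dU (Ystep t t1).
  by apply: Ymix; lia.
apply: (le_trans (ler_sum_nat step)); rewrite 2!big_split /= -mulr_sumr.
rewrite (telescope_sumr (fun t => \tr (U *m mlog (Y t)))) ?(leqW rs)//.
rewrite sumr_const_nat mulNrn.
rewrite [_ * ln (1 - alpha)]mulr_natl.
have := mxtrace_mlog_mixed_ge mu0 dU (Ymix r _).
have := mxtrace_mlog_mixed_le0 mu0 dU (Ymix s.+1 _).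
have -> : (2 <= s.+1 <= T.+1)%N by lia.
have -> : (2 <= r <= T.+1)%N by lia.
move=> /(_ isT) h1 /(_ isT) h2.
by rewrite lerD2r lerD2l; lra.
Qed.

End Mixing.

(** * Scalar estimates for the choice of eta and alpha *)

Section Tuning.
Variable R : realType.

(** This is ln(1 + y) <= y at y = -x/(1 + x), where 1 + y = 1/(1 + x). *)
Lemma ln1D_ge (x : R) : 0 < x -> x / (1 + x) <= ln (1 + x).
Proof.
move=> x0; have x1 : 0 < 1 + x by rewrite addr_gt0.
have xE : (1 + x)^-1 = 1 + - (x / (1 + x)) by field; rewrite gt_eqF.
rewrite -[leRHS]opprK -lnV ?posrE// lerNr {1}xE.
apply: le_ln1Dx; rewrite ltrN2 ltr_pdivrMr//; lra.
Qed.

(** With d = sqrt(2D/L) one has d/(1 + d) <= eta <= d and dL = sqrt(2LD). So eta L <= dL and D/eta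
    <= D + D/d = D + dL/2. *)
Lemma tuned_rate_bound (L D : R) : 0 < L -> 0 < D ->
  let eta := ln (1 + Num.sqrt (2 * D / L)) in
  0 < eta /\ eta * L + D / eta <= 2 * Num.sqrt (2 * L * D) + D.
Proof.
move=> L0 D0 eta; pose d := Num.sqrt (2 * D / L).
have d0 : 0 < d by rewrite sqrtr_gt0 divr_gt0// mulr_gt0.
have d2 : d ^+ 2 * L = 2 * D.
  by rewrite sqr_sqrtr ?divfK ?gt_eqF// ltW// divr_gt0// mulr_gt0.
have -> : Num.sqrt (2 * L * D) = d * L.
  rewrite (_ : 2 * L * D = (d * L) ^+ 2) ?sqrtr_sqr ?ger0_norm//.
    by rewrite mulr_ge0// ltW.
  by rewrite mulrAC -d2; ring.
have eta_ge : d / (1 + d) <= eta by exact: ln1D_ge.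
have d1 : 0 < 1 + d by rewrite addr_gt0.
have eta0 : 0 < eta by rewrite (lt_le_trans _ eta_ge)// divr_gt0.
have eta_le : eta <= d by apply: le_ln1Dx; rewrite (lt_trans _ d0)// ltrN10.
split=> //.
have etaL : eta * L <= d * L by rewrite ler_pM2r.
have : D / eta <= D / (d / (1 + d)).
  by rewrite ler_pM2l// lef_pV2 ?posrE// divr_gt0.
have -> : D / (d / (1 + d)) = D + d * L / 2.
  have -> : D = d ^+ 2 * L / 2 by rewrite d2 mulrC mulKf.
  by field; rewrite !gt_eqF.
have dL : 0 < d * L by rewrite mulr_gt0.
lra.
Qed.

(** Isolates the comparator's loss B above a quantity free of U, the shape to which [le_best_fixed]
    applies. *)
Lemma solve_loss_bound (e A B D : R) : 0 < e ->
  e / (1 + e) * A - D <= e * B -> (A - D - D / e) / (1 + e) <= B.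
Proof.
move=> e0 h; have e1 : 0 < 1 + e by rewrite addr_gt0.
have -> : A - D - D / e = (1 + e) / e * (e / (1 + e) * A - D).
  by field; rewrite !gt_eqF.
rewrite ler_pdivrMr// (_ : B * (1 + e) = (1 + e) / e * (e * B)).
  by rewrite ler_wpM2l// divr_ge0// ltW.
by field; rewrite gt_eqF.
Qed.

(** For alpha = 1/(T + 1) each round costs -ln(1 - alpha) = ln(1 + 1/T) <= 1/T, hence at most 1 over
    k <= T rounds: the summand 1 in D. *)
Lemma mixing_cost_le (n T k : nat) : (0 < T)%N -> (k <= T)%N ->
  - ln (T.+1%:R^-1 / n.+1%:R) - k%:R * ln (1 - T.+1%:R^-1) <=
  ln (n.+1%:R * (1 + T%:R)) + 1 :> R.
Proof.
move=> T0 kT.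
have T0' : 0 < T%:R :> R by rewrite ltr0n.
rewrite -invfM lnV ?posrE ?mulr_gt0// opprK.
rewrite [T.+1%:R * _]mulrC nat1r lerD2l.
have -> : 1 - T.+1%:R^-1 = (1 + T%:R^-1)^-1 :> R.
  by rewrite -nat1r; field; rewrite !gt_eqF// ?addr_gt0// ltr_pwDl.
rewrite lnV ?posrE ?addr_gt0 ?invr_gt0// mulrN opprK.
have ln_le : ln (1 + T%:R^-1) <= T%:R^-1 :> R.
  by apply: le_ln1Dx; rewrite (lt_trans (ltrN10 _))// invr_gt0.
apply: (@le_trans _ _ (T%:R * T%:R^-1)); last by rewrite divff// gt_eqF.
by rewrite ler_pM ?ler_nat// ln_ge0// lerDl invr_ge0 ltW.
Qed.

End Tuning.

(** * Regret on intervals that avoid the first round, then on all intervals *)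

Lemma late_interval_bound (R : realType) (n T : nat) (C Y : nat -> 'M[R]_n.+1)
    (L : R) (r s : nat) :
  let alpha := (T.+1%:R)^-1 in
  let D := ln (n.+1%:R * (1 + T%:R)) + 1 in
  let eta := ln (1 + Num.sqrt (2 * D / L)) in
  (0 < T)%N -> 0 < L ->
  (forall t, (1 <= t <= T)%N ->
    symmx (C t) /\ loewner_le 0 (C t) /\ loewner_le (C t) 1%:M) ->
  (forall t, (1 <= t <= T)%N -> fs_step eta alpha (Y t) (C t) (Y t.+1)) ->
  (2 <= r)%N -> (r <= s)%N -> (s <= T)%N -> best_fixed C r s <= L ->
  alg_loss Y C r s - best_fixed C r s <= 2 * (Num.sqrt (2 * L * D) + D).
Proof.
move=> alpha D eta T0 L0 Cok Ystep r2 rs sT BL.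
have D1 : 1 <= D.
  by rewrite lerDr ln_ge0// nat1r -natrM ler1n.
have [eta0 rate] := tuned_rate_bound L0 (lt_le_trans ltr01 D1).
rewrite -/eta in eta0 rate.
have al : 0 < alpha < 1.
  by rewrite invr_gt0 ltr0n /= invf_lt1 ?ltr0n// ltr1n ltnS.
have e1 : 0 < 1 + eta by rewrite addr_gt0.
have sr : (s.+1 - r <= T)%N by lia.
have lossB : (alg_loss Y C r s - D - D / eta) / (1 + eta) <= best_fixed C r s.
  apply: le_best_fixed => U dU; apply: solve_loss_bound => //.
  have reg := interval_regret eta0 al Cok Ystep dU r2 rs sT.
  by rewrite lerBlDr (le_trans reg)// -addrA lerD2l; exact: mixing_cost_le.
(* The regret is now at most D + (eta L + D/eta), and [rate] bounds the bracket by 2 sqrt(2LD) + D;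
   hence the factor 2. *)
have : eta * best_fixed C r s <= eta * L by rewrite ler_pM2l.
rewrite ler_pdivrMr// mulrDr mulr1 in lossB.
have := sqrtr_ge0 (2 * L * D).
by clearbody eta D; lra.
Qed.

Theorem theorem4p4 (R : realType) :
  exists c : R, 0 < c /\
  forall (n T : nat) (C Y : nat -> 'M[R]_n) (L : R),
    (0 < n)%N -> (1 <= T)%N ->
    (forall t, (1 <= t <= T)%N ->
       symmx (C t) /\ loewner_le 0 (C t) /\ loewner_le (C t) 1%:M) ->
    0 < L ->
    (forall r s, (1 <= r)%N -> (r <= s)%N -> (s <= T)%N ->
       best_fixed C r s <= L) ->
    let alpha := (T.+1%:R)^-1 in
    let D := ln (n%:R * (1 + T%:R)) + 1 in
    let eta := ln (1 + Num.sqrt (2 * D / L)) in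
    Y 1%N \in dens_mx n ->
    (forall t, (1 <= t <= T)%N -> fs_step eta alpha (Y t) (C t) (Y t.+1)) ->
    forall r s, (1 <= r)%N -> (r <= s)%N -> (s <= T)%N ->
      alg_loss Y C r s - best_fixed C r s <= c * (Num.sqrt (2 * L * D) + D).
Proof.
(* The constant 3 is 2 from intervals starting at round 2 or later, plus 1 for the first round,
   whose loss is at most 1 <= D. *)
exists 3; split=> // n T C Y L; case: n C Y => // n C Y _ T0 Cok L0 BL.
move=> alpha D eta; rewrite inE => -[psdY1 trY1] Ystep r s r1 rs sT.
have late r' s' := @late_interval_bound R n T C Y L r' s' T0 L0 Cok Ystep.
have S0 := sqrtr_ge0 (2 * L * D).
have D1 : 1 <= D by rewrite lerDr ln_ge0// nat1r -natrM ler1n.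
have [r2|] := leqP 2 r.
  by apply: (le_trans (late _ _ r2 rs sT (BL _ _ r1 rs sT))); rewrite -/D; lra.
rewrite ltnS => r1'; have rE : r = 1%N by lia.
rewrite rE in rs *.
(* [Y 1] may be singular, so the first round is charged its full loss, at most
   [1]; from the second round on the mixing step keeps [Y t] positive. *)
have [C0 C1] : loewner_le 0 (C 1%N) /\ loewner_le (C 1%N) 1%:M.
  by apply: (Cok 1%N _).2; rewrite T0.
have loss1 : \tr (Y 1%N *m C 1%N) <= 1.
  have := mxtrace_mul_psd_ge0 psdY1 C1.
  by rewrite mulmxBr mulmx1 linearB /= trY1 subr_ge0.
have Cpsd t : (1 <= t <= s)%N -> loewner_le 0 (C t).
  by move=> ts; apply: (Cok t _).2.1; lia.
rewrite /alg_loss big_ltn ?ltnS// -/(alg_loss Y C 2 s).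
have [s2|] := leqP 2 s; last first.
  rewrite ltnS => s1'; have -> : s = 1%N by lia.
  rewrite /alg_loss big_geq// addr0.
  have : 0 <= best_fixed C 1 1.
    apply: le_best_fixed => U [psdU _]; rewrite big_nat1.
    by apply: mxtrace_mul_psd_ge0 => //; move: C0; rewrite /loewner_le subr0.
  lra.
(* Dropping round 1 can only lower the comparator's loss, so the regret on [1, s] is at most 1 plus
   the regret on [2, s]. *)
have mono : best_fixed C 2 s <= best_fixed C 1 s.
  apply: le_best_fixed => U dU; rewrite big_ltn ?ltnS//.
  apply: (le_trans (best_fixed_le _ dU)).
    by move=> t ts; apply: Cpsd; lia.
  rewrite lerDr; apply: mxtrace_mul_psd_ge0 dU.1 _.
  by move: C0; rewrite /loewner_le subr0.
have := late 2 s isT s2 sT (BL 2%N s isT s2 sT); rewrite -/D.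
lra.
Qed.
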